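(* Let $\Pi$ be a partition of $[n]$ with at least two blocks. Let $c := |[1]_{\widehat\Pi}|$ and $d := |[n]_{\widehat\Pi}|$, and assume $S_\Pi \ne S_n^{c,d}$. Then for an integer $i\ge 1$, we have $\mathrm{Comp}_{n+i}(S_\Pi) = S^{c,d}_{n+i}$ or $\mathrm{Comp}_{n+i}(S_\Pi) = \langle S^{c,d}_{n+i},\delta_{n+i}\rangle$ if and only if $i \ge \max(M(\Pi)-1,1)$.
   Context: $S_n$ is the symmetric group on $[n]=\{1,\dots,n\}$; $\delta_n$ is $i\mapsto n+1-i$. For a partition $\Pi$ of $[n]$, $S_\Pi=\{\pi\in S_n: \pi(B)=B \text{ for all } B\in\Pi\}$. $\widehat{\Pi}$ is the coarsest partition of $[n]$ into intervals refining $\Pi$; $[1]_{\widehat\Pi}$ and $[n]_{\widehat\Pi}$ are its blocks containing $1$ and $n$. $M(\Pi)$ is the maximum of $1$ and the sizes of the blocks of $\widehat\Pi$ other than $[1]_{\widehat\Pi}$ and $[n]_{\widehat\Pi}$. For positive integers $a,b$ with $a+b\le m$, $S^{a,b}_m$ is the group of permutations of $[m]$ that map each of the intervals $\{1,\dots,a\}$ and $\{m-b+1,\dots,m\}$ onto itself and fix every point of $\{a+1,\dots,m-b\}$. A permutation $\pi\in S_m$ involves $\tau\in S_n$ ($n\le m$) if there are indices $i_1<\dots<i_n$ with $\pi(i_j)<\pi(i_k)$ iff $\tau(j)<\tau(k)$ for all $j,k$; such $\tau$ is an $n$-pattern of $\pi$. For $S\subseteq S_n$, $\mathrm{Comp}_m(S)$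 is the set of $\tau\in S_m$ all of whose $n$-patterns belong to $S$. *)

(* Defs.v *)
From mathcomp Require Import all_boot all_fingroup.
Set Implicit Arguments.
Unset Strict Implicit.
Unset Printing Implicit Defensive.
Local Open Scope group_scope.

(* [m] = {1, ..., m} is modelled by 'I_m = {0, ..., m-1}: all positions and
   values are shifted down by one. *)

Definition delta m : 'S_m := perm (@rev_ord_inj m).

Definition partition_stabiliser m (Pi : {set {set 'I_m}}) : {set 'S_m} :=
  [set s : 'S_m | [forall B in Pi, s @: B == B]].

Definition is_interval m (B : {set 'I_m}) : bool :=
  [forall x in B, forall y in B, forall z : 'I_m, (x <= z <= y) ==> (z \in B)].

Definition refines m (P Q : {set {set 'I_m}}) : bool :=
  [forall B in P, exists C in Q, B \subset C].

Definition interval_refinement m (Pi H : {set {set 'I_m}}) : bool :=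
  [&& partition H [set: 'I_m], [forall B in H, is_interval B] & refines H Pi].

Definition coarsest_interval_refinement m (Pi H : {set {set 'I_m}}) : bool :=
  interval_refinement Pi H &&
  [forall K, interval_refinement Pi K ==> refines K H].

(* The default value is never used when Pi is a partition: see hatP and
   hat_uniq below. *)
Definition hat m (Pi : {set {set 'I_m}}) : {set {set 'I_m}} :=
  odflt Pi [pick H | coarsest_interval_refinement Pi H].

Definition first_block n (Pi : {set {set 'I_n.+1}}) : {set 'I_n.+1} :=
  pblock (hat Pi) ord0.

Definition last_block n (Pi : {set {set 'I_n.+1}}) : {set 'I_n.+1} :=
  pblock (hat Pi) ord_max.

Definition M n (Pi : {set {set 'I_n.+1}}) : nat :=
  maxn 1 (\max_(B in hat Pi | (B != first_block Pi) && (B != last_block Pi)) #|B|).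

Definition Sab a b m : {set 'S_m} :=
  [set s : 'S_m | [&& s @: [set x : 'I_m | x < a] == [set x : 'I_m | x < a],
                      s @: [set x : 'I_m | m - b <= x] == [set x : 'I_m | m - b <= x]
                    & [forall x : 'I_m, (a <= x < m - b) ==> (s x == x)]]].

Definition involves m n (s : 'S_m) (t : 'S_n) : bool :=
  [exists f : {ffun 'I_n -> 'I_m},
     [forall j : 'I_n, forall k : 'I_n, (j < k) ==> (f j < f k)] &&
     [forall j : 'I_n, forall k : 'I_n, (s (f j) < s (f k)) == (t j < t k)]].

Definition Comp m n (S : {set 'S_n}) : {set 'S_m} :=
  [set s : 'S_m | [forall t : 'S_n, involves s t ==> (t \in S)]].

Section Hat.
Variables (m : nat) (Pi : {set {set 'I_m}}).
Hypothesis PiP : partition Pi [set: 'I_m].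

Let between (x y z : 'I_m) := (minn x y <= z <= maxn x y).
Let R : rel 'I_m :=
  [rel x y | [forall z, between x y z ==> (pblock Pi z == pblock Pi x)]].

Let RP x y :
  reflect (forall z, between x y z -> pblock Pi z = pblock Pi x) (R x y).
Proof.
apply: (iffP forallP) => h z; first by move/(implyP (h z))/eqP.
by apply/implyP => /h ->.
Qed.

Let eqR : {in [set: 'I_m] & &, equivalence_rel R}.
Proof.
have Rxx x : R x x.
  apply/RP => z; rewrite /between minnn maxnn -eqn_leq => /eqP e.
  by congr pblock; apply/val_inj.
have Rsym x y : R x y -> R y x.
  move=> /RP h; have hy : pblock Pi y = pblock Pi x.
    by apply: h; rewrite /between geq_minr leq_maxr.
  apply/RP => z; rewrite /between minnC maxnC hy; exact: h.
have Rtr y x z : R x y -> R y z -> R x z.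
  move=> /RP h1 /RP h2; apply/RP => w.
  have hy : pblock Pi y = pblock Pi x.
    by apply: h1; rewrite /between geq_minr leq_maxr.
  rewrite /between geq_min leq_max => hw.
  case b1: (between x y w); first exact: h1.
  rewrite -hy; apply: h2; move: hw b1.
  rewrite /between !geq_min !leq_max.
  by case: (ltngtP x w); case: (ltngtP y w); case: (ltngtP z w).
move=> x y z _ _ _; split => // rxy; apply/idP/idP; first exact/Rtr/Rsym.
exact: Rtr.
Qed.

Let covPi x : x \in cover Pi.
Proof. by rewrite (cover_partition PiP) inE. Qed.

Let trivPi : trivIset Pi.
Proof. by case/and3P: PiP. Qed.

Lemma coarsest_interval_refinement_exists :
  coarsest_interval_refinement Pi (equivalence_partition R [set: 'I_m]).
Proof.
set H := equivalence_partition R _.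
have HP : partition H [set: 'I_m] by apply: equivalence_partitionP eqR.
have hR x y : (y \in pblock H x) = R x y.
  by apply: (pblock_equivalence_partition eqR); rewrite inE.
have HB B : B \in H -> exists x, B = pblock H x.
  move=> BH; case/and3P: (HP) => _ tH nH.
  have /set0Pn[x xB] : B != set0 by apply: contraNneq nH => <-.
  by exists x; rewrite (def_pblock tH BH xB).
have Rblock x y : R x y -> pblock Pi y = pblock Pi x.
  by move/RP; apply; rewrite /between geq_minr leq_maxr.
apply/andP; split; first apply/and3P; first split=> //.
- apply/forall_inP => B /HB[a ->]; apply/forall_inP => x; rewrite hR => ax.
  apply/forall_inP => y; rewrite hR => ay; apply/forallP => z.
  apply/implyP => /andP[xz zy]; rewrite hR; apply/RP => w.
  rewrite /between geq_min leq_max => hw.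
  have [wa|aw] := leqP w a.
    move: hw; rewrite wa /= => /andP[/orP[aw|zw] _].
      by congr pblock; apply/val_inj/eqP; rewrite eqn_leq wa.
    move/RP: ax; apply; rewrite /between geq_min leq_max wa /=.
    by rewrite (leq_trans xz zw) orbT.
  move: hw; rewrite (ltnW aw) (leqNgt w a) aw /= => wz.
  move/RP: ay; apply; rewrite /between geq_min leq_max (ltnW aw) /=.
  by rewrite (leq_trans wz zy) orbT.
- apply/forall_inP => B /HB[a ->]; apply/exists_inP; exists (pblock Pi a).
    exact: pblock_mem.
  apply/subsetP => y; rewrite hR => /Rblock <-; by rewrite mem_pblock.
apply/forallP => K; apply/implyP => /and3P[/and3P[_ tK nK] /forall_inP iK].
move=> /forall_inP rK; apply/forall_inP => B BK.
have /set0Pn[x xB] : B != set0 by apply: contraNneq nK => <-.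
have xH : x \in cover H by rewrite (cover_partition HP) inE.
apply/exists_inP; exists (pblock H x); first exact: pblock_mem.
have /exists_inP[C CPi /subsetP BC] := rK _ BK.
apply/subsetP => y yB; rewrite hR; apply/RP => z hz.
have zB : z \in B.
  have /forall_inP iB := iK _ BK.
  have /forall_inP/(_ _ yB)/forallP/(_ z)/implyP i1 := iB _ xB.
  have /forall_inP/(_ _ xB)/forallP/(_ z)/implyP i2 := iB _ yB.
  move: hz; rewrite /between; case: (leqP x y) => _; [exact: i1 | exact: i2].
by rewrite (def_pblock trivPi CPi (BC _ zB)) (def_pblock trivPi CPi (BC _ xB)).
Qed.

Lemma hatP : coarsest_interval_refinement Pi (hat Pi).
Proof.
rewrite /hat; case: pickP => //= h.
by move: coarsest_interval_refinement_exists; rewrite h.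
Qed.

Lemma hat_uniq H : coarsest_interval_refinement Pi H -> H = hat Pi.
Proof.
have sub K L : coarsest_interval_refinement Pi K ->
    coarsest_interval_refinement Pi L -> {subset K <= L}.
  case/andP=> iK /forallP cK /andP[iL /forallP cL] B BK.
  have /forall_inP/(_ _ BK)/exists_inP[C CL BC] := implyP (cL K) iK.
  have /forall_inP/(_ _ CL)/exists_inP[D DK CD] := implyP (cK L) iL.
  case/and3P: iK => /and3P[_ tK nK] _ _.
  have /set0Pn[x xB] : B != set0 by apply: contraNneq nK => <-.
  have xD : x \in D by apply: (subsetP CD); apply: (subsetP BC).
  have e : B = D by rewrite -(def_pblock tK BK xB) (def_pblock tK DK xD).
  suff -> : B = C by [].
  by apply/eqP; rewrite eqEsubset BC e.
move=> cH; apply/setP => B; apply/idP/idP; apply: sub => //; exact: hatP.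
Qed.

End Hat.

(* Main.v *)
Require Import Defs.
From mathcomp Require Import all_boot all_fingroup.
From mathcomp Require Import zify.
Local Open Scope group_scope.

(** Call [r] a cut when [r] and [r.+1] lie in different blocks of [Pi]; the
    blocks of [hat Pi] are the maximal intervals without cuts inside. If two
    patterns of [s] arise by deleting the same points except for one of two
    adjacent points with values [u < v], they differ by a cycle on an interval of
    values, which therefore crosses no cut. Choosing the deleted points freely,
    this forces any permutation in [Comp] to be a walk [s 0, s 1, ...] whose
    steps outside the two extreme blocks have length 1, or length 2 over isolated
    values when [M Pi <= i.+1]. Such a Hamiltonian walk has to sweep the middle
    values in increasing or in decreasing order, so [s] or its reverse lies in
    [Sab c d _]. If [M Pi > i.+1], an adjacent transposition at distance
    at least [i] from the left end of a large middle block survives in [Comp]. *)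

(** * Patterns as rank functions, and the group structure of [Comp] *)

Lemma card_ord_lt {n : nat} (a : nat) : a <= n -> #|[set x : 'I_n | x < a]| = a.
Proof.
move=> an; have wI : injective (widen_ord an) by move=> x y [] /val_inj.
rewrite -[RHS]card_ord -(card_imset _ wI).
apply: eq_card => x; rewrite inE; apply/idP/imsetP => [xa|[y _ ->]] //=.
by exists (Ordinal xa) => //; apply: val_inj.
Qed.

Lemma perm_rank {n : nat} (t : 'S_n) (x : 'I_n) : #|[set y | t y < t x]| = t x.
Proof.
rewrite -[RHS](@card_ord_lt n) 1?ltnW // -(card_imset _ (@perm_inj _ t)).
apply: eq_card => y; rewrite inE; apply/imsetP/idP => [[z]|yx].
  by rewrite inE => zx ->.
by exists (t^-1 y); rewrite ?inE permKV.
Qed.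

(** Counting: [t x] is the number of arguments with smaller value. For [x < a] they lie among the
    other arguments below [a]; for [a <= x] they include all of those. *)
Lemma perm_split {n : nat} (t : 'S_n) (a : nat) :
    (forall x y : 'I_n, x < a -> a <= y -> t x < t y) ->
  forall x, (t x < a) = (x < a).
Proof.
move=> h x; case: (leqP a n) => [an|na]; last by rewrite !(ltn_trans _ na).
have cA := card_ord_lt a an; have [xa|ax] := ltnP x a.
  rewrite -perm_rank -cA; apply/proper_card/properP; split.
    apply/subsetP => y; rewrite !inE ltnNge => yx.
    by rewrite ltnNge; apply: contra yx => ay; apply/ltnW/h.
  by exists x; rewrite !inE ?ltnn.
apply/negbTE; rewrite -leqNgt -perm_rank -{1}cA; apply/subset_leq_card/subsetP.
by move=> y; rewrite !inE => ya; apply: h.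
Qed.

Lemma pattern_rank {n m : nat} (g : 'I_n -> 'I_m) (t : 'S_n) :
    (forall x y, (g x < g y) = (t x < t y)) ->
  forall x, t x = #|[set y | g y < g x]| :> nat.
Proof. by move=> h x; rewrite -perm_rank; apply: eq_card => y; rewrite !inE h. Qed.

Lemma pattern_uniq {n m : nat} (g : 'I_n -> 'I_m) (t t' : 'S_n) :
    (forall x y, (g x < g y) = (t x < t y)) ->
    (forall x y, (g x < g y) = (t' x < t' y)) -> t = t'.
Proof.
move=> h h'; apply/permP => x; apply/val_inj => /=.
by rewrite (pattern_rank g t h) (pattern_rank g t' h').
Qed.

Lemma pattern_exists {n m : nat} (g : 'I_n -> 'I_m) :
  injective g -> exists t : 'S_n, forall x y, (g x < g y) = (t x < t y).
Proof.
move=> gI; pose r x := #|[set y | g y < g x]|.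
have r_mono x y : g x < g y -> r x < r y.
  move=> xy; apply/proper_card/properP; split.
    by apply/subsetP => z; rewrite !inE => /ltn_trans; apply.
  by exists x; rewrite !inE ?ltnn.
have rE x y : (r x < r y) = (g x < g y).
  have [/r_mono //|yx|/val_inj/gI ->] := ltngtP (g x) (g y); last by rewrite ltnn.
  by apply/negbTE; rewrite -leqNgt ltnW ?r_mono.
have rn x : r x < n.
  rewrite -[n in _ < n]card_ord -cardsT; apply/proper_card/properP.
  by split; [exact: subsetT | exists x; rewrite !inE ?ltnn].
have rI : injective (fun x => Ordinal (rn x)).
  move=> x y [e]; have [/r_mono|/r_mono|/val_inj/gI //] := ltngtP (g x) (g y).
    by rewrite e ltnn.
  by rewrite e ltnn.
by exists (perm rI) => x y; rewrite !permE /= rE.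
Qed.

Lemma involvesP {m n : nat} (s : 'S_m) (t : 'S_n) :
  reflect (exists f : 'I_n -> 'I_m,
             (forall j k : 'I_n, j < k -> f j < f k) /\
             (forall j k, (s (f j) < s (f k)) = (t j < t k)))
          (involves s t).
Proof.
apply: (iffP existsP) => [[f /andP[/forallP h1 /forallP h2]]|[f [h1 h2]]].
  exists f; split=> j k; first by move/forallP: (h1 j) => /(_ k)/implyP.
  by move/forallP: (h2 j) => /(_ k)/eqP.
exists [ffun x => f x]; apply/andP; split; apply/forallP=> j; apply/forallP=> k.
  by apply/implyP; rewrite !ffunE; apply: h1.
by rewrite !ffunE h2.
Qed.

Lemma increasing_inj {n m : nat} (f : 'I_n -> 'I_m) :
  (forall j k : 'I_n, j < k -> f j < f k) -> injective f.
Proof.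
move=> h x y e; have [/h|/h|/val_inj //] := ltngtP x y; by rewrite e ltnn.
Qed.

Lemma increasing_lt {n m : nat} (f : 'I_n -> 'I_m) :
    (forall j k : 'I_n, j < k -> f j < f k) ->
  forall j k, (f j < f k) = (j < k).
Proof.
move=> h j k; have [/h -> //|/h /ltnW|/val_inj ->] := ltngtP j k.
  by rewrite ltnNge => ->.
by rewrite ltnn.
Qed.

Lemma increasing_ge {n m : nat} (f : 'I_n -> 'I_m) :
  (forall j k : 'I_n, j < k -> f j < f k) -> forall k : 'I_n, k <= f k.
Proof.
move=> h [k kn] /=; elim: k kn => // k IH kn; have k'n := ltnW kn.
exact: leq_ltn_trans (IH k'n) (h (Ordinal k'n) (Ordinal kn) (ltnSn k)).
Qed.

Lemma increasing_le {n i : nat} (f : 'I_n -> 'I_(n + i)) :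
  (forall j k : 'I_n, j < k -> f j < f k) -> forall k : 'I_n, f k <= k + i.
Proof.
move=> h k; pose g x := rev_ord (f (rev_ord x)).
have /increasing_ge/(_ (rev_ord k)) : forall j k : 'I_n, j < k -> g j < g k.
  move=> x y xy; have := h (rev_ord y) (rev_ord x); rewrite /g /=; have := ltn_ord y.
  have := ltn_ord (f (rev_ord x)); lia.
rewrite /g rev_ordK /=; have := ltn_ord (f k); have := ltn_ord k; lia.
Qed.

Lemma CompP {m n : nat} (S : {set 'S_n}) (s : 'S_m) :
  reflect (forall t, involves s t -> t \in S) (s \in Comp m S).
Proof. by rewrite inE; apply: (iffP forallP) => h t; apply/implyP; apply: h. Qed.

(** The pattern of [s * s'] on the positions [f] is the pattern of [s] on [f] times that of [s'] on
    the sorted positions [s (f x)]. *)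
Lemma Comp_group_set {m n : nat} (G : {group 'S_n}) : group_set (Comp m G).
Proof.
apply/group_setP; split.
  apply/CompP => t /involvesP[f [fi ft]].
  suff -> : t = 1 by apply: group1.
  apply: (pattern_uniq f) => x y; first by rewrite -ft !perm1.
  by rewrite !perm1 increasing_lt.
move=> s s' /CompP Gs /CompP Gs'; apply/CompP => t /involvesP[f [fi ft]].
have sfI : injective (fun x => s (f x)).
  by move=> x y /perm_inj/(increasing_inj f fi).
have [t1 h1] := pattern_exists _ sfI.
pose g x := s (f (t1^-1 x)).
have gi (j k : 'I_n) : j < k -> g j < g k by rewrite /g h1 !permKV.
have sgI : injective (fun x => s' (g x)).
  by move=> x y /perm_inj/(increasing_inj g gi).
have [t2 h2] := pattern_exists _ sgI.
have -> : t = t1 * t2.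
  apply: (pattern_uniq (fun x => s' (s (f x)))) => x y; first by rewrite -ft !permM.
  by rewrite !permM -h2 /g !permK.
apply: groupM; [apply: Gs | apply: Gs'].
  by apply/involvesP; exists f.
by apply/involvesP; exists g.
Qed.

(** * Cuts and the blocks of [hat Pi] *)

Section Cuts.

Context {n : nat} (Pi : {set {set 'I_n.+1}}).

(** The guard [r < n] keeps both [inord]s away from their default value. *)
Definition cut (r : nat) : bool :=
  (r < n) && (pblock Pi (inord r) != pblock Pi (inord r.+1)).

(** A numerical label whose level sets are the blocks of [hat Pi], by [mem_hat]. *)
Definition cuts_below (x : nat) : nat := \sum_(0 <= r < x) cut r.

Lemma cut_lt {r : nat} : cut r -> r < n.
Proof. by case/andP. Qed.

Lemma cuts_below_eqP {x y : nat} :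
  x <= y -> reflect (forall r, x <= r < y -> ~~ cut r) (cuts_below x == cuts_below y).
Proof.
move=> xy; rewrite /cuts_below [X in _ == X](big_cat_nat (n := x)) //=.
rewrite -[X in X == _]addn0 eqn_add2l eq_sym sum_nat_seq_eq0.
apply: (iffP allP) => h r.
  by move=> rxy; have := h r; rewrite mem_index_iota rxy => /(_ isT); case: (cut r).
by rewrite mem_index_iota => /h /negbTE ->.
Qed.

Lemma cuts_below_mono {x y : nat} : x <= y -> cuts_below x <= cuts_below y.
Proof.
by move=> xy; rewrite /cuts_below [leqRHS](big_cat_nat (n := x)) //= leq_addr.
Qed.

Lemma cuts_below_pblock (x y : 'I_n.+1) :
  cuts_below x = cuts_below y -> pblock Pi x = pblock Pi y.
Proof.
wlog xy : x y / x <= y => [hw e|/eqP/(cuts_below_eqP xy) nc].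
  by case/orP: (leq_total x y) => /hw ->.
suff h k : x <= k <= y -> pblock Pi (inord k) = pblock Pi x.
  by rewrite -(h y) ?inord_val // xy leqnn.
elim: k => [|k IH]; rewrite ?leqn0.
  by move=> /andP[/eqP e _]; congr pblock; apply: val_inj; rewrite /= inordK ?e.
rewrite leq_eqVlt => /andP[/orP[/eqP <- _|xk ky]]; first by rewrite inord_val.
rewrite -IH ?(ltnW ky) ?andbT //.
have := nc k; rewrite -ltnS xk ky => /(_ isT); rewrite /cut negb_and negbK.
by rewrite (leq_trans ky) -1?ltnS // => /eqP ->.
Qed.

(** A block of [hat Pi] is an interval inside one block of [Pi], so it crosses no cut. Conversely,
    the level sets of [cuts_below] form an interval refinement, so coarseness puts each inside a
    block of [hat Pi]. *)
Lemma mem_hat (PiP : partition Pi [set: 'I_n.+1]) (x y : 'I_n.+1) :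
  (y \in pblock (hat Pi) x) = (cuts_below x == cuts_below y).
Proof.
have /andP[/and3P[HP /forall_inP iH /forall_inP rH] /forallP cH] := hatP PiP.
have covH z : z \in cover (hat Pi) by rewrite (cover_partition HP) inE.
have /and3P[_ tH nH] := HP; have /and3P[_ tPi nPi] := PiP.
apply/idP/idP => [yx|/eqP xy].
  have xx : x \in pblock (hat Pi) x by rewrite mem_pblock.
  have BH : pblock (hat Pi) x \in hat Pi by apply: pblock_mem.
  move: yx xx BH; move: (pblock _ x) => B.
  wlog xy : x y / x <= y => [hw yB xB BH|yB xB BH].
    case/orP: (leq_total x y) => /hw; first exact.
    by rewrite eq_sym; apply.
  apply/(cuts_below_eqP xy) => r /andP[xr ry].
  have rn : r < n by rewrite -ltnS (leq_ltn_trans ry).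
  have /exists_inP[C CPi /subsetP BC] := rH _ BH.
  have zC (z : 'I_n.+1) : x <= z <= y -> pblock Pi z = C.
    move=> hz; apply: def_pblock => //; apply: BC.
    by have /forall_inP/(_ _ xB)/forall_inP/(_ _ yB)/forallP/(_ z)/implyP := iH _ BH; apply.
  have er : (inord r : 'I_n.+1) = r :> nat by rewrite inordK // ltnW.
  have er' : (inord r.+1 : 'I_n.+1) = r.+1 :> nat by rewrite inordK.
  by rewrite /cut rn /= negbK !zC ?er ?er' ?xr ?ry ?(ltnW ry) ?(leqW xr).
pose K := preim_partition (fun z : 'I_n.+1 => cuts_below z) [set: 'I_n.+1].
have KP : partition K [set: 'I_n.+1] by apply: preim_partitionP.
have memK a b : (b \in pblock K a) = (cuts_below a == cuts_below b).
  by rewrite pblock_equivalence_partition ?inE // => u v w _ _ _; split=> // /eqP ->.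
have covK z : z \in cover K by rewrite (cover_partition KP) inE.
have KE B : B \in K -> exists a, B = pblock K a.
  move=> BK; case/and3P: (KP) => _ tK nK.
  have /set0Pn[a aB] : B != set0 by apply: contraNneq nK => <-.
  by exists a; rewrite (def_pblock tK BK aB).
have iK : interval_refinement Pi K.
  apply/and3P; split=> //.
    apply/forall_inP => B /KE[a ->]; apply/forall_inP => u; rewrite memK => /eqP au.
    apply/forall_inP => v; rewrite memK => /eqP av; apply/forallP => w.
    apply/implyP => /andP[/cuts_below_mono uw /cuts_below_mono wv]; rewrite memK.
    by rewrite eqn_leq {1}au uw av wv.
  apply/forall_inP => B /KE[a ->]; apply/exists_inP; exists (pblock Pi a).
    by apply: pblock_mem; rewrite (cover_partition PiP) inE.
  apply/subsetP => z; rewrite memK => /eqP/cuts_below_pblock ->.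
  by rewrite mem_pblock (cover_partition PiP) inE.
have /forall_inP/(_ (pblock K x)) := implyP (cH K) iK.
rewrite pblock_mem // => /(_ isT)/exists_inP[C CH /subsetP KC].
by rewrite (def_pblock tH CH (KC x _)) ?memK // KC // memK xy.
Qed.

Lemma partition_stabiliserP (PiP : partition Pi [set: 'I_n.+1]) (s : 'S_n.+1) :
  reflect (forall x, pblock Pi (s x) = pblock Pi x) (s \in partition_stabiliser Pi).
Proof.
have /and3P[_ tPi nPi] := PiP.
have cov z : z \in cover Pi by rewrite (cover_partition PiP) inE.
rewrite inE; apply: (iffP forall_inP) => [h x|h B BPi].
  have BPi : pblock Pi x \in Pi by apply: pblock_mem.
  apply: def_pblock => //; rewrite -(eqP (h _ BPi)).
  by rewrite imset_f // mem_pblock.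
rewrite eqEcard card_imset ?leqnn ?andbT; last exact: perm_inj.
apply/subsetP => _ /imsetP[x xB ->].
by rewrite -(def_pblock tPi BPi xB) -h mem_pblock.
Qed.

Lemma partition_stabiliser_group_set (PiP : partition Pi [set: 'I_n.+1]) :
  group_set (partition_stabiliser Pi).
Proof.
apply/group_setP; split=> [|s t /(partition_stabiliserP PiP) hs /(partition_stabiliserP PiP) ht].
  by apply/(partition_stabiliserP PiP) => x; rewrite perm1.
by apply/(partition_stabiliserP PiP) => x; rewrite permM ht hs.
Qed.

(** Since [x] and [t x] lie on the same side of every cut, equally many cuts lie below them. *)
Lemma split_cuts_stabiliser (PiP : partition Pi [set: 'I_n.+1]) (t : 'S_n.+1) :
    (forall r, cut r -> forall x, (t x <= r) = (x <= r)) ->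
  t \in partition_stabiliser Pi.
Proof.
move=> h; apply/(partition_stabiliserP PiP) => x; apply: cuts_below_pblock.
suff E (y : 'I_n.+1) : cuts_below y = \sum_(0 <= r < n.+1) (cut r && (r < y)).
  rewrite !E; apply: eq_bigr => r _.
  by have [/h/(_ x)|] := boolP (cut r); rewrite // ![_ < _]ltnNge => ->.
have yn := ltnW (ltn_ord y).
rewrite (big_cat_nat (n := y)) //= [X in _ = _ + X]big1_seq ?addn0.
  by apply: eq_big_nat => r /andP[_ ->]; rewrite andbT.
by move=> r; rewrite mem_index_iota => /andP[_ /andP[yr _]]; rewrite ltnNge yr andbF.
Qed.

Lemma exists_cut (PiP : partition Pi [set: 'I_n.+1]) :
  2 <= #|Pi| -> exists r, cut r.
Proof.
move=> Pi2; have [[r cr]|nc] := altP (@existsP 'I_n cut); first by exists r.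
have : #|Pi| <= #|[set pblock Pi ord0]|.
  apply/subset_leq_card/subsetP => B BPi; have /and3P[_ tPi nPi] := PiP.
  have /set0Pn[x xB] : B != set0 by apply: contraNneq nPi => <-.
  rewrite inE -(def_pblock tPi BPi xB); apply/eqP/cuts_below_pblock/eqP.
  rewrite eq_sym; apply/(cuts_below_eqP (leq0n x)) => r /andP[_ rx].
  have rn : r < n by rewrite -ltnS (leq_ltn_trans rx).
  by move/existsPn: nc => /(_ (Ordinal rn)).
by rewrite cards1 leqNgt Pi2.
Qed.

End Cuts.

Section Blocks.

Context {n : nat} (Pi : {set {set 'I_n.+1}}).
Hypotheses (PiP : partition Pi [set: 'I_n.+1]) (Pi2 : 2 <= #|Pi|).

Let c := #|first_block Pi|.
Let d := #|last_block Pi|.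

Lemma first_blockP :
  [/\ 0 < c, cut Pi c.-1, forall r, cut Pi r -> c.-1 <= r
    & forall y, (y \in first_block Pi) = (y < c)].
Proof.
have [r0 cr0 r0min] := ex_minnP (exists_cut Pi PiP Pi2).
have r0n := cut_lt Pi cr0.
have memE y : (y \in first_block Pi) = (y < r0.+1).
  rewrite mem_hat //; apply/(cuts_below_eqP Pi (leq0n y))/idP => [h|yr r ry].
    by rewrite ltnS leqNgt; apply/negP => r0y; move/negP: (h r0 r0y); apply.
  by apply/negP => /r0min; lia.
suff -> : c = r0.+1 by [].
rewrite -(@card_ord_lt n.+1 r0.+1) ?ltnS ?(ltnW r0n) //.
by apply: eq_card => y; rewrite memE inE.
Qed.

Lemma last_blockP :
  [/\ 0 < d, d <= n, cut Pi (n - d), forall r, cut Pi r -> r <= n - d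
    & forall y, (y \in last_block Pi) = (n - d < y)].
Proof.
have ubn r : cut Pi r -> r <= n by move/(cut_lt Pi)/ltnW.
have [r1 cr1 r1max] := ex_maxnP (exists_cut Pi PiP Pi2) ubn.
have r1n := cut_lt Pi cr1.
have memE y : (y \in last_block Pi) = (r1 < y).
  rewrite mem_hat // eq_sym.
  apply/(cuts_below_eqP Pi (leq_ord y : y <= ord_max))/idP => [h|yr r ry].
    by rewrite ltnNge; apply/negP => yr; have := h r1; rewrite yr r1n cr1 => /(_ isT).
  by apply/negP => /r1max; lia.
have dE : d = n - r1.
  have := cardsC [set x : 'I_n.+1 | x < r1.+1].
  rewrite card_ord card_ord_lt ?ltnS ?(ltnW r1n) //.
  suff -> : #|~: [set x : 'I_n.+1 | x < r1.+1]| = d by lia.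
  by apply: eq_card => y; rewrite !inE memE -leqNgt.
have e : n - d = r1 by lia.
rewrite e; split=> //; lia.
Qed.

(** The points [k], ..., [k + i.+1] share a block of [hat Pi] exactly when none of [k], ..., [k + i]
    is a cut. So a middle block larger than [i.+1] amounts to a window of [i.+1] non-cuts. *)
Lemma M_leP (i : nat) :
  M Pi <= i.+1 <->
  (forall k, c <= k -> k + i < n - d -> exists2 r, cut Pi r & k <= r <= k + i).
Proof.
have [c0 cc cmin firstE] := first_blockP; have [d0 dn cd dmax lastE] := last_blockP.
have /andP[/and3P[HP _ _] _] := hatP PiP; have /and3P[_ tH nH] := HP.
have covH z : z \in cover (hat Pi) by rewrite (cover_partition HP) inE.
split=> [|h].
  rewrite /M geq_max => /andP[_ /bigmax_leqP hM] k ck kd.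
  have kn : k < n.+1 by lia.
  pose x := Ordinal kn; pose B := pblock (hat Pi) x.
  have xB : x \in B by rewrite mem_pblock.
  have Bi : #|B| <= i.+1.
    apply: hM; rewrite pblock_mem //=; apply/andP; split.
      by apply: contraTneq xB => ->; rewrite firstE -leqNgt.
    by apply: contraTneq xB => ->; rewrite lastE -leqNgt /=; lia.
  have [/existsP[r /andP[cr hr]]|/existsPn nc] :=
      boolP [exists r : 'I_n, cut Pi r && (k <= r <= k + i)].
    by exists r.
  suff : k + i.+2 <= k + #|B| by lia.
  rewrite -(@card_ord_lt n.+1 (k + i.+2)); last lia.
  rewrite -{2}(@card_ord_lt n.+1 k); last lia.
  apply: leq_trans (leq_card_setU _ _); apply/subset_leq_card/subsetP => y.
  rewrite !inE => yk; have [//|ky /=] := ltnP y k.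
  rewrite mem_hat //; apply/(cuts_below_eqP Pi (ky : x <= y)) => r /= hr.
  apply/negP => cr; move: (nc (Ordinal (cut_lt Pi cr))); rewrite /= cr /=; lia.
rewrite /M geq_max /=; apply/bigmax_leqP => B /and3P[BH Bf Bl].
have /set0Pn[x xB] : B != set0 by apply: contraNneq nH => <-.
have [p pB pmin] := arg_minnP (fun z : 'I_n.+1 => z : nat) xB.
have BE : pblock (hat Pi) p = B by apply: def_pblock.
have notfirst z : z \in B -> c <= z.
  move=> zB; rewrite leqNgt -firstE; apply: contra Bf => zf.
  by rewrite -(def_pblock tH BH zB) /first_block (same_pblock tH zf).
have notlast z : z \in B -> z <= n - d.
  move=> zB; rewrite leqNgt -lastE; apply: contra Bl => zf.
  by rewrite -(def_pblock tH BH zB) /last_block (same_pblock tH zf).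
(* Either [B] fits into the [i.+1] places from its minimum [p] on, or some [q] in [B] lies beyond
   them and the window at [p] has a cut separating [p] from [q]. *)
have [/subsetP Bsub|/subsetPn[q qB]] := boolP (B \subset [set x : 'I_n.+1 | p <= x <= p + i]).
  have : #|[set x : 'I_n.+1 | x < p] :|: B| <= #|[set x : 'I_n.+1 | x < minn n.+1 (p + i.+1)]|.
    apply/subset_leq_card/subsetP => z; rewrite !inE leq_min ltn_ord addnS ltnS.
    by case/orP=> [/ltnW/leq_trans|/Bsub]; [apply; apply: leq_addr | rewrite inE => /andP[]].
  rewrite card_ord_lt ?geq_minl // cardsU disjoint_setI0 ?cards0 ?subn0.
    by rewrite card_ord_lt ?(ltnW (ltn_ord p)) // leq_min leq_add2l => /andP[].
  rewrite disjoint_sym disjoints_subset; apply/subsetP => z zB.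
  by rewrite !inE -leqNgt pmin.
rewrite inE (pmin q qB) /= -ltnNge => pq.
have [|r cr /andP[pr rp]] := h p (notfirst _ pB).
  exact: leq_trans pq (notlast _ qB).
have : q \in pblock (hat Pi) p by rewrite BE.
rewrite mem_hat // => /(cuts_below_eqP Pi (pmin q qB)) nc.
by have /nc/negP[] : p <= r < q by rewrite pr (leq_ltn_trans rp pq).
Qed.

End Blocks.

(** * Elements of [Comp] as walks *)

(* Keep [n.+1] points of [s] with consecutive values starting at [s x - r],
   skipping the value of [y] but including [x]; replacing [x] by its neighbour
   [y] then yields a second pattern. The point of value-rank [r.+1] in the first
   pattern has value-rank [r] in the second and the same position in both, so a
   group containing both patterns cannot separate [r] from [r.+1]. *)
Lemma Comp_no_cut {n : nat} (Pi : {set {set 'I_n.+1}}) (i r : nat)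
    (s : 'S_(n.+1 + i)) (x y : 'I_(n.+1 + i)) :
    partition Pi [set: 'I_n.+1] -> s \in Comp (n.+1 + i) (partition_stabiliser Pi) ->
    0 < i -> cut Pi r -> (x.+1 == y) || (y.+1 == x) ->
  s x + 2 <= s y -> s x < r + i -> ~~ (r + 2 <= s y).
Proof.
move=> PiP /CompP sC i0 cr xy uv ur; apply/negP => rv.
have rn := cut_lt Pi cr.
pose G := group (partition_stabiliser_group_set Pi PiP).
(* The subtraction is truncated: for [u < r] the selected values start at 0. Either way [u] gets
   rank at most [r], the value of rank [r.+1] stays below [v], and [ur] makes the selection fit. *)
set u := s x in uv ur; set v := s y in uv rv; pose a := u - r.
have gb (z : 'I_n.+1) : a + z + (v <= a + z) < n.+1 + i.
  by have := ltn_ord z; have := leq_b1 (v <= a + z); lia.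
pose g z := Ordinal (gb z).
have gi (j k : 'I_n.+1) : j < k -> g j < g k by rewrite /g /=; lia.
have gv z : g z != v by apply/eqP => /(congr1 val) /=; lia.
have kb : u - a < n.+1 by lia.
pose k := Ordinal kb.
have gk : g k = u by apply: val_inj => /=; lia.
pose p z := s^-1 (g z).
have pI : injective p by move=> z w /perm_inj/(increasing_inj g gi).
have [t tE] := pattern_exists p pI.
pose f w := p (t^-1 w).
have fi (j l : 'I_n.+1) : j < l -> f j < f l by rewrite /f tE !permKV.
have sf w : s (f w) = g (t^-1 w) by rewrite /f permKV.
(* [t] sends value-ranks to position-ranks, so the pattern on the positions [f] is [t^-1]. *)
have t1G : t^-1 \in G.
  apply: sC; apply/involvesP; exists f; split=> // j l.
  by rewrite !sf (increasing_lt g gi).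
have fx w : (f w == x) = (w == t k).
  rewrite -(inj_eq (@perm_inj _ s)) sf -/u -gk (inj_eq (increasing_inj g gi)).
  exact: can2_eq (permKV t) (permK t) _ _.
have fy w : f w != y by rewrite -(inj_eq (@perm_inj _ s)) sf gv.
pose f' w := if f w == x then y else f w.
have f'i (j l : 'I_n.+1) : j < l -> f' j < f' l.
  move/fi => jl; rewrite /f'; have := fy j; have := fy l; rewrite -!val_eqE /=.
  by case: ifP; case: ifP => /=; lia.
have sf'I : injective (fun w => s (f' w)).
  by move=> j l /perm_inj/(increasing_inj f' f'i).
have [t' t'E] := pattern_exists _ sf'I.
have t'G : t' \in G by apply: sC; apply/involvesP; exists f'.
have tt'G : t * t' \in G by rewrite groupM // -groupV.
pose h z := s (f' (t z)).
have hE z : h z = if z == k then v else g z.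
  by rewrite /h /f' fx (inj_eq (@perm_inj _ t)); case: ifP; rewrite // sf permK.
have hk (j l : 'I_n.+1) : (h j < h l) = ((t * t')%g j < (t * t')%g l).
  by rewrite /h t'E !permM.
have Rb : r.+1 < n.+1 by [].
have rb : r < n.+1 by lia.
have E : (t * t') (Ordinal Rb) = Ordinal rb.
  apply: val_inj; rewrite /= (pattern_rank h _ hk).
  have : #|[set z : 'I_n.+1 | z < r.+1] :\ k| = r.
    have := cardsD1 k [set z : 'I_n.+1 | z < r.+1]; rewrite card_ord_lt; last lia.
    by rewrite inE (_ : k < r.+1 = true) /=; lia.
  move=> {2}<-; apply: eq_card => z; rewrite !inE !hE.
  have -> : (Ordinal Rb == k) = false by apply/negbTE; rewrite -val_eqE /=; lia.
  by have [-> | zk] := eqVneq z k; rewrite /=; lia.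
move: cr; rewrite /cut rn /= => /negP; apply; apply/eqP.
have /(partition_stabiliserP Pi PiP)/(_ (Ordinal Rb)) := tt'G; rewrite E.
move=> e; congr (_ = _): e; congr pblock; apply: val_inj; rewrite /= inordK //.
Qed.

Section Walks.

Context {m : nat} (s : 'S_m.+1).

(** Both orders of the neighbours are quantified over, so excluding upward jumps over [w] also
    excludes downward ones. *)
Definition unjumped (w : nat) : bool :=
  [forall x : 'I_m.+1, forall y : 'I_m.+1,
     ((x.+1 == y) || (y.+1 == x)) ==> (s x < w) ==> ~~ (w < s y)].

(** A discrete intermediate value argument: the walk changes sides of [w] only by visiting it. *)
Lemma unjumped_side (w x y : 'I_m.+1) :
    unjumped w -> x <= y -> (forall z : 'I_m.+1, x <= z <= y -> s z != w) ->
  (s x < w) = (s y < w).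
Proof.
move=> /forallP uw; case: y => y ym /=; elim: y ym => [|y IH] ym xy nw.
  by congr (s _ < _); apply: val_inj => /=; lia.
move: xy; rewrite leq_eqVlt => /orP[/eqP e|xy].
  by congr (s _ < _); apply: val_inj.
have ym' := ltnW ym; rewrite (IH ym') // => [|z /andP[xz zy]]; last first.
  by rewrite nw // xz ltnW.
have h1 := nw (Ordinal ym'); have h2 := nw (Ordinal ym).
have /forallP/(_ (Ordinal ym)) := uw (Ordinal ym').
have /forallP/(_ (Ordinal ym')) := uw (Ordinal ym).
rewrite /= eqxx orbT /=; move: h1 h2; rewrite /= -!val_eqE /=; lia.
Qed.

(** The walk stays below [w] until it visits [w]. The value [w.+1], available since [w < m], comes
    later and keeps everything after the visit above [w]. So the position of [w] splits [s], and
    counting makes it equal to [w]. *)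
Lemma unjumped_fix (w : 'I_m.+1) :
    w < m -> unjumped w -> s ord0 < w ->
  s w = w /\ forall x, (s x < w) = (x < w).
Proof.
move=> wm uw s0; pose p := s^-1 w; have sp : s p = w by rewrite permKV.
have spE x : (s x == w) = (x == p) by rewrite -{1}sp (inj_eq (@perm_inj _ s)).
have lt (x : 'I_m.+1) : x < p -> s x < w.
  move=> xp; rewrite -(unjumped_side w ord0 x) // => z /andP[_ zx].
  by rewrite spE -val_eqE /=; lia.
have vb : w.+1 < m.+1 by [].
pose q := s^-1 (Ordinal vb); have sq : s q = w.+1 :> nat by rewrite permKV.
have pq : p < q.
  rewrite ltnNge leq_eqVlt negb_or; apply/andP; split.
    by apply/eqP => /val_inj e; move: sq; rewrite e sp; lia.
  by apply/negP => /lt; rewrite sq; lia.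
have gt (x : 'I_m.+1) : p < x -> w < s x.
  move=> px; have swx : s x != w by rewrite spE -val_eqE /=; lia.
  suff : ~~ (s x < w) by move: swx; rewrite -val_eqE /=; lia.
  have : ~~ (s q < w) by rewrite sq; lia.
  case/orP: (leq_total x q) => xq;
    [rewrite (unjumped_side w x q) // | rewrite (unjumped_side w q x) //];
    by move=> z hz; rewrite spE -val_eqE /=; lia.
have le (x : 'I_m.+1) : p <= x -> w <= s x.
  by rewrite leq_eqVlt => /orP[/eqP/val_inj <-|/gt/ltnW //]; rewrite sp.
have ltE x : (s x < p) = (x < p).
  by apply: perm_split => {}x y /lt sx /le; apply: leq_trans.
have leE x : (s x < p.+1) = (x < p.+1).
  apply: perm_split => {}x y; rewrite ltnS => xp /gt; apply: leq_ltn_trans.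
  by move: xp; rewrite leq_eqVlt => /orP[/eqP/val_inj ->|/lt/ltnW //]; rewrite sp.
have pw : p = w.
  apply: val_inj; have := ltE p; have := leE p; rewrite sp /=; lia.
by split; [rewrite -{1}pw | rewrite -pw].
Qed.

(** The value 0 is met before or after [w], and from there the walk reaches the end on that side
    without meeting [w]. *)
Lemma unjumped_end (w : 'I_m.+1) :
  0 < w -> unjumped w -> s ord0 < w \/ s ord_max < w.
Proof.
move=> w0 uw; pose p := s^-1 w; have sp : s p = w by rewrite permKV.
have spE x : (s x == w) = (x == p) by rewrite -{1}sp (inj_eq (@perm_inj _ s)).
pose q := s^-1 ord0; have sq : s q < w by rewrite permKV.
have [pq|qp|/val_inj e] := ltngtP p q; last by rewrite -e sp ltnn in sq.
  right; rewrite -(unjumped_side w q) ?leq_ord // => z /andP[qz _].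
  by rewrite spE -val_eqE /=; lia.
left; rewrite (unjumped_side w _ q) // => z /andP[_ zq].
by rewrite spE -val_eqE /=; lia.
Qed.

End Walks.

Lemma imset_perm_stable {T : finType} (s : {perm T}) (A : {set T}) :
  (forall x, x \in A -> s x \in A) -> s @: A = A.
Proof.
move=> h; apply/eqP; rewrite eqEcard card_imset ?leqnn ?andbT; last exact: perm_inj.
by apply/subsetP => _ /imsetP[x xA ->]; apply: h.
Qed.

Lemma delta_val {m : nat} (x : 'I_m) : delta m x = m - x.+1 :> nat.
Proof. by rewrite permE. Qed.

Lemma delta_mulK {m : nat} : delta m * delta m = 1.
Proof. by apply/permP => x; rewrite permM !permE /= rev_ordK. Qed.

(** * Rigidity of walks that respect the cuts *)

Section Core.

Context {n : nat} (Pi : {set {set 'I_n.+1}}) (i : nat).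
Hypotheses (PiP : partition Pi [set: 'I_n.+1]) (Pi2 : 2 <= #|Pi|) (i0 : 0 < i).

Let c := #|first_block Pi|.
Let d := #|last_block Pi|.

(** By [M_leP] this says [M Pi <= i.+1]. *)
Hypothesis gaps :
  forall k, c <= k -> k + i < n - d -> exists2 r, cut Pi r & k <= r <= k + i.

(** The conclusion of [Comp_no_cut], isolated because it is invariant under reversing the walk. The
    degree [(n + i).+1], convertible to [n.+1 + i], gives access to [ord0] and [ord_max]. *)
Definition respects_cuts (s : 'S_(n + i).+1) : Prop :=
  forall (x y : 'I_(n + i).+1) r, (x.+1 == y) || (y.+1 == x) -> cut Pi r ->
  s x + 2 <= s y -> s x < r + i -> ~~ (r + 2 <= s y).

Lemma respects_cuts_delta (s : 'S_(n + i).+1) :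
  respects_cuts s -> respects_cuts (delta _ * s).
Proof.
move=> h x y r xy; rewrite !permM; apply: h.
by rewrite !delta_val; have := ltn_ord x; have := ltn_ord y; lia.
Qed.

(* A jump over [w] must go from [w.-1] to [w.+1], with a block of exactly
   [i.+1] elements ending at [w]. *)
Lemma jumped_cut (s : 'S_(n + i).+1) (w : nat) :
    respects_cuts s -> c <= w <= n + i - d -> ~~ unjumped s w ->
  [/\ c < w, w <= n - d, cut Pi w & ~~ cut Pi w.-1].
Proof.
have [c0 cc cmin _] := first_blockP Pi PiP Pi2.
have [d0 dn cd dmax _] := last_blockP Pi PiP Pi2.
rewrite -/c -/d in c0 cc cmin d0 dn cd dmax.
move=> hs /andP[cw wd] /forallPn[x /forallPn[y]].
rewrite !negb_imply => /and4P[xy uw wv _].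
have uv : s x + 2 <= s y by lia.
have hx r := hs x y r xy ^~ uv.
have hc := hx _ cc; have hd := hx _ cd.
(* The cut [c.-1] forbids jumping over [w >= c] from a value below [c.-1 + i]. *)
have cu : c <= s x + 1 - i by lia.
have [kd|kd] := ltnP (s x + 1) (n - d).
  (* Every [r] in this window satisfies [s x < r + i], so [s y <= r + 1 <= s x + 2]; with [uv] this
     leaves only [r = w]. *)
  have [|r cr hr] := gaps (s x + 1 - i) cu; first by lia.
  have hr' := hx _ cr; have e : r = w by lia.
  rewrite -e; split=> //; [lia | lia | apply/negP => /hx].
  lia.
have e : n - d = w by lia.
rewrite -e; split=> //; [lia | apply/negP => /hx].
lia.
Qed.

(** Values not jumped over are fixed by [unjumped_fix]. If [w] is jumped over, [w.-1] and [w.+1] are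
    not: by [jumped_cut] the former would need a cut at [w.-1], the latter a non-cut at [w]. They
    then pin down [s w]. *)
Lemma respects_cuts_Sab (s : 'S_(n + i).+1) :
  respects_cuts s -> s ord0 < c -> s \in Sab c d (n + i).+1.
Proof.
have [c0 cc cmin _] := first_blockP Pi PiP Pi2.
have [d0 dn cd dmax _] := last_blockP Pi PiP Pi2.
rewrite -/c -/d in c0 cc cmin d0 dn cd dmax.
have cnd := cmin _ cd.
move=> hs s0.
have U (w : 'I_(n + i).+1) : c <= w <= n + i - d -> unjumped s w ->
    s w = w /\ forall x, (s x < w) = (x < w).
  by move=> /andP[cw wd] uw; apply: unjumped_fix => //; lia.
have fixw (w : 'I_(n + i).+1) : c <= w <= n + i - d -> s w = w.
  move=> hw; have [/U[] //|jw] := boolP (unjumped s w).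
  have [cw wd cutw ncutw] := jumped_cut s w hs hw jw.
  have b1 : w.-1 < (n + i).+1 by lia.
  have b2 : w.+1 < (n + i).+1 by lia.
  have [||e1 h1] := U (Ordinal b1); rewrite /=; first by lia.
    apply: contraT => /(jumped_cut s _ hs)[]; first by lia.
    by move=> _ _ cw1; rewrite cw1 in ncutw.
  have [||_ h2] := U (Ordinal b2); rewrite /=; first by lia.
    apply: contraT => /(jumped_cut s _ hs)[]; first by lia.
    by rewrite /= cutw.
  have := h1 w; have := h2 w; rewrite /= => h2w h1w.
  have : s w != Ordinal b1.
    by rewrite -e1 (inj_eq (@perm_inj _ s)) -val_eqE /=; lia.
  by rewrite -val_eqE /= => ne; apply: val_inj => /=; lia.
have cb : c < (n + i).+1 by lia.
have db : n + i - d < (n + i).+1 by lia.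
(* The extreme values [c] and [n + i - d] are never jumped over, since [jumped_cut] gives
   [c < w <= n - d]. *)
have [||_ hc] := U (Ordinal cb) => /=; first by lia.
  by apply: contraT => /(jumped_cut s _ hs)[]; lia.
have [||ed hd] := U (Ordinal db) => /=; first by lia.
  by apply: contraT => /(jumped_cut s _ hs)[]; lia.
rewrite inE !imset_perm_stable ?eqxx /=.
- by apply/forallP => x; apply/implyP => hx; apply/eqP/fixw; lia.
- move=> x; rewrite !inE => dx; have := hd x => /= hdx.
  have : s x != Ordinal db.
    by rewrite -ed (inj_eq (@perm_inj _ s)) -val_eqE /=; lia.
  by rewrite -val_eqE /=; lia.
by move=> x; rewrite !inE (hc x).
Qed.

(** As [c] is not jumped over, the walk starts or ends below [c]; in the second case its reversal
    starts there. *)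
Lemma Comp_sub_Sab (s : 'S_(n.+1 + i)) :
    s \in Comp (n.+1 + i) (partition_stabiliser Pi) ->
  s \in Sab c d (n.+1 + i) \/ delta (n.+1 + i) * s \in Sab c d (n.+1 + i).
Proof.
have [c0 cc cmin _] := first_blockP Pi PiP Pi2.
have [d0 dn cd dmax _] := last_blockP Pi PiP Pi2.
rewrite -/c -/d in c0 cc cmin d0 dn cd dmax.
have cnd := cmin _ cd.
move=> sC; have hs : respects_cuts s.
  by move=> x y r xy cr uv ur; apply: (Comp_no_cut Pi i r s x y).
have cb : c < (n + i).+1 by lia.
have [||s0|s0] := unjumped_end s (Ordinal cb) => //=.
- by apply: contraT => /(jumped_cut s _ hs)[]; lia.
- by left; apply: respects_cuts_Sab.
right; apply: respects_cuts_Sab; first exact: respects_cuts_delta.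
rewrite permM; suff -> : delta (n + i).+1 ord0 = ord_max by [].
by apply: val_inj; rewrite /= delta_val subn1.
Qed.

End Core.

(** * Elements of [Sab] and transpositions in [Comp] *)

Lemma SabP {a b m : nat} {s : 'S_m} :
    s \in Sab a b m ->
  [/\ forall x, (s x < a) = (x < a), forall x, (m - b <= s x) = (m - b <= x)
    & forall x : 'I_m, a <= x < m - b -> s x = x].
Proof.
rewrite inE => /and3P[/eqP ha /eqP hb /forallP h]; split=> x.
- by have := mem_imset [set z : 'I_m | z < a] x (@perm_inj _ s); rewrite ha !inE.
- by have := mem_imset [set z : 'I_m | m - b <= z] x (@perm_inj _ s); rewrite hb !inE.
by move=> hx; apply/eqP/(implyP (h x)).
Qed.

Lemma pattern_split {n m : nat} {s : 'S_m} {t : 'S_n} {f : 'I_n -> 'I_m} {a b : nat} :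
    (forall j k, (s (f j) < s (f k)) = (t j < t k)) ->
    (forall x, (f x < b) = (x < a)) -> (forall z, (s z < b) = (z < b)) ->
  forall x, (t x < a) = (x < a).
Proof.
move=> ft fb sb; apply: perm_split => x y xa ay; rewrite -ft.
have sx : s (f x) < b by rewrite sb fb.
by apply: leq_trans sx _; rewrite leqNgt sb fb -leqNgt.
Qed.

Lemma delta_involves {m n : nat} : n <= m -> involves (delta m) (delta n).
Proof.
move=> nm; apply/involvesP; exists (widen_ord nm); split=> // j k.
by rewrite !delta_val /=; have := ltn_ord j; have := ltn_ord k; lia.
Qed.

(** An explicit group containing [Sab c c m] and [delta m]: an upper bound for the group they
    generate, in which membership is easy to refute. *)
Definition middle_trivial_or_reversed (c m : nat) : {set 'S_m} :=
  [set s : 'S_m | [forall x : 'I_m, (c <= x < m - c) ==> (s x == x)]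
               || [forall x : 'I_m, (c <= x < m - c) ==> (s x == rev_ord x)]].

Lemma middle_trivial_or_reversedP {c m : nat} (s : 'S_m) :
  reflect ((forall x : 'I_m, c <= x < m - c -> s x = x) \/
           (forall x : 'I_m, c <= x < m - c -> s x = rev_ord x))
          (s \in middle_trivial_or_reversed c m).
Proof.
rewrite inE; apply: (iffP orP) => [[] /forallP h|[] h].
- by left=> x hx; apply/eqP/(implyP (h x)).
- by right=> x hx; apply/eqP/(implyP (h x)).
- by left; apply/forallP=> x; apply/implyP=> /h ->.
by right; apply/forallP=> x; apply/implyP=> /h ->.
Qed.

Lemma middle_trivial_or_reversed_group_set (c m : nat) :
  group_set (middle_trivial_or_reversed c m).
Proof.
have rev_mid (x : 'I_m) : c <= x < m - c -> c <= rev_ord x < m - c by rewrite /=; lia.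
apply/group_setP; split=> [|s t].
  by apply/middle_trivial_or_reversedP; left=> x _; rewrite perm1.
move=> /middle_trivial_or_reversedP[] hs /middle_trivial_or_reversedP[] ht;
  apply/middle_trivial_or_reversedP.
- by left=> x hx; rewrite permM hs // ht.
- by right=> x hx; rewrite permM hs // ht.
- by right=> x hx; rewrite permM hs // ht // rev_mid.
by left=> x hx; rewrite permM hs // ht ?rev_mid // rev_ordK.
Qed.

Lemma gen_Sab_delta_sub (c m : nat) :
  <<Sab c c m :|: [set delta m]>> \subset middle_trivial_or_reversed c m.
Proof.
rewrite (gen_subG _ (group (middle_trivial_or_reversed_group_set c m))).
apply/subsetP => s; rewrite in_setU in_set1 => hs.
apply/middle_trivial_or_reversedP; case/orP: hs => [/SabP[_ _ h]|/eqP ->]; first by left.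
by right=> x _; rewrite permE.
Qed.

Section Containments.

Context {n : nat} (Pi : {set {set 'I_n.+1}}) (i : nat).
Hypotheses (PiP : partition Pi [set: 'I_n.+1]) (Pi2 : 2 <= #|Pi|).

Let c := #|first_block Pi|.
Let d := #|last_block Pi|.

(** For a cut [r], the embedding sends [r.+1] to a position between [c] and [n.+1 + i - d]. Every
    threshold in that range is preserved by [s], so the pattern preserves the threshold [r.+1]. *)
Lemma Sab_sub_Comp :
  Sab c d (n.+1 + i) \subset Comp (n.+1 + i) (partition_stabiliser Pi).
Proof.
have [c0 cc cmin _] := first_blockP Pi PiP Pi2.
have [d0 dn cd dmax _] := last_blockP Pi PiP Pi2.
rewrite -/c -/d in c0 cc cmin d0 dn cd dmax.
apply/subsetP => s /SabP[hc hd hm]; apply/CompP => t /involvesP[f [fi ft]].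
apply: (split_cuts_stabiliser Pi PiP) => r cr x.
have rb : r.+1 < n.+1 by have := cut_lt Pi cr.
have h1 := increasing_ge f fi (Ordinal rb); have h2 := increasing_le f fi (Ordinal rb).
apply: (pattern_split ft (increasing_lt f fi ^~ (Ordinal rb))) => z.
have := cmin r cr; have := dmax r cr; have := hc z; have := hd z; rewrite /= in h1 h2.
have [/hm -> //|] := boolP (c <= z < n.+1 + i - d); lia.
Qed.

(** The shorter reversal is a pattern of the longer one. Preserving the blocks of [Pi], it maps cuts
    to cuts and so exchanges the least, [c.-1], with the greatest, [n - d]. *)
Lemma Comp_delta_card_blocks :
  delta (n.+1 + i) \in Comp (n.+1 + i) (partition_stabiliser Pi) -> c = d.
Proof.
have [c0 cc cmin _] := first_blockP Pi PiP Pi2.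
have [d0 dn cd dmax _] := last_blockP Pi PiP Pi2.
rewrite -/c -/d in c0 cc cmin d0 dn cd dmax.
move=> /CompP/(_ _ (delta_involves (leq_addr _ _))) /(partition_stabiliserP Pi PiP) h.
have cut_rev r : cut Pi r -> cut Pi (n.-1 - r).
  move=> /andP[rn]; rewrite /cut -(h (inord r)) -(h (inord r.+1)) => ne.
  apply/andP; split; first by lia.
  move: ne; rewrite eq_sym; congr (pblock _ _ != pblock _ _);
    by apply: val_inj; rewrite /= delta_val !inordK; lia.
by have := cmin _ (cut_rev _ cd); have := dmax _ (cut_rev _ cc); lia.
Qed.

(* Deleting at most [i] points before the exchanged pair keeps it inside the
   middle block containing [k], ..., [k + i.+1]. *)
Lemma Comp_large_gap (k : nat) :
    0 < i -> c <= k -> k + i < n - d ->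
    (forall r, cut Pi r -> ~~ (k <= r <= k + i)) ->
  Comp (n.+1 + i) (partition_stabiliser Pi) <> Sab c d (n.+1 + i) /\
  Comp (n.+1 + i) (partition_stabiliser Pi)
    <> <<Sab c d (n.+1 + i) :|: [set delta (n.+1 + i)]>>.
Proof.
move=> i0 ck kd nc.
have qb : k + i < n.+1 + i by lia.
have qb' : (k + i).+1 < n.+1 + i by lia.
pose s := tperm (Ordinal qb) (Ordinal qb').
have sq : s (Ordinal qb) = Ordinal qb' by rewrite tpermL.
have s_split b : b != (k + i).+1 -> forall z, (s z < b) = (z < b).
  by move=> nb z; rewrite /s; case: tpermP => [->|->|] //=; lia.
have sC : s \in Comp (n.+1 + i) (partition_stabiliser Pi).
  apply/CompP => t /involvesP[f [fi ft]].
  apply: (split_cuts_stabiliser Pi PiP) => r cr x.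
  have rb : r.+1 < n.+1 by have := cut_lt Pi cr.
  have fE := increasing_lt f fi.
  have [e|ne] := eqVneq (f (Ordinal rb) : nat) (k + i).+1; last first.
    by apply: (pattern_split ft (fE ^~ (Ordinal rb))); apply: s_split.
  (* Now [r <= f r <= k + i], and [r] is outside the window, so [r < k]. Hence
     [f r <= r + i < k + i]: the first exchanged point is not selected, and [k + i] can serve as
     threshold. *)
  have fr : f (Ordinal (ltnW rb)) < f (Ordinal rb) by apply: fi.
  have h1 := increasing_ge f fi (Ordinal (ltnW rb)).
  have h2 := increasing_le f fi (Ordinal (ltnW rb)).
  have nr := nc r cr; rewrite /= in h1 h2.
  apply: (pattern_split (a := r.+1) (b := k + i) ft) => [z|]; last by apply: s_split; lia.
  have h3 := fE z (Ordinal rb); have h4 := fE (Ordinal (ltnW rb)) z.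
  rewrite /= in h3 h4; lia.
have cS : s \notin Sab c d (n.+1 + i).
  apply/negP => /SabP[_ _ /(_ (Ordinal qb))]; rewrite sq /= => h.
  by have /(congr1 val) /= := h ltac:(lia); lia.
split=> e; first by rewrite -e sC in cS.
have dC : delta (n.+1 + i) \in Comp (n.+1 + i) (partition_stabiliser Pi).
  by rewrite e mem_gen // in_setU in_set1 eqxx orbT.
have cdE := Comp_delta_card_blocks dC.
move: sC; rewrite e -cdE => /(subsetP (gen_Sab_delta_sub _ _)).
case/middle_trivial_or_reversedP => h.
  by have /(congr1 val) /= := h (Ordinal qb) ltac:(rewrite /=; lia); rewrite sq /=; lia.
(* [s] fixes [c] because [c <= k < k + i], whereas the mirror image of [c] is larger than [c]. *)
have cb : c < n.+1 + i by lia.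
have /(congr1 val) := h (Ordinal cb) ltac:(rewrite /=; lia).
by rewrite /s tpermD -?val_eqE /=; lia.
Qed.

End Containments.

(** * Both directions of the equivalence *)

Theorem theorem4p10 (n : nat) (Pi : {set {set 'I_n.+1}})
    (PiP : partition Pi [set: 'I_n.+1]) (Pi2 : 2 <= #|Pi|)
    (c d : nat) (hc : c = #|first_block Pi|) (hd : d = #|last_block Pi|)
    (hS : partition_stabiliser Pi <> Sab c d n.+1)
    (i : nat) (hi : 1 <= i) :
  (Comp (n.+1 + i) (partition_stabiliser Pi) = Sab c d (n.+1 + i) \/
   Comp (n.+1 + i) (partition_stabiliser Pi)
     = <<Sab c d (n.+1 + i) :|: [set delta (n.+1 + i)]>>)
  <-> maxn (M Pi - 1) 1 <= i.
Proof.
have -> : (maxn (M Pi - 1) 1 <= i) = (M Pi <= i.+1) by lia.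
rewrite hc hd; split=> [hC|/(M_leP Pi PiP Pi2) gaps].
  apply/(M_leP Pi PiP Pi2) => k ck kd.
  have [/existsP[r /andP[cr hr]]|/existsPn nc] :=
      boolP [exists r : 'I_n, cut Pi r && (k <= r <= k + i)].
    by exists r.
  have [|n1 n2] := Comp_large_gap Pi i PiP Pi2 k hi ck kd; last by case: hC.
  by move=> r cr; have := nc (Ordinal (cut_lt Pi cr)); rewrite /= cr.
pose G := group (partition_stabiliser_group_set Pi PiP).
pose H := group (@Comp_group_set (n.+1 + i) _ G).
have SH : Sab #|first_block Pi| #|last_block Pi| (n.+1 + i) \subset H.
  exact: Sab_sub_Comp.
have HS := Comp_sub_Sab Pi i PiP Pi2 hi gaps.
have [HsubS|/subsetPn[s sH sS]] :=
    boolP (H \subset Sab #|first_block Pi| #|last_block Pi| (n.+1 + i)).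
  by left; apply/eqP; rewrite eqEsubset HsubS.
right; apply/eqP; rewrite eqEsubset; apply/andP; split.
  apply/subsetP => t /HS[tS|tS]; first by rewrite mem_gen // in_setU tS.
  rewrite -[t]mul1g -delta_mulK -mulgA groupM // mem_gen // in_setU ?tS //.
  by rewrite in_set1 eqxx orbT.
(* An element outside [Sab] has its reversal in [Sab], hence in the group [H], which puts [delta]
   itself into [H]. *)
have dH : delta (n.+1 + i) \in H.
  case: (HS s sH) => [|/(subsetP SH)]; first by rewrite (negbTE sS).
  by rewrite groupMr.
by rewrite (gen_subG _ H) subUset SH sub1set.
Qed.
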